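(* Let $w\in S_n$ and $1\le i\le n-1$. If $\mathrm{length}(ws_i)<\mathrm{length}(w)$, then $\mathcal{RP}(ws_i)$ is equal to the disjoint union $\bigsqcup_{D\in\mathcal{RP}(w)}\mathrm{mitosis}_i(D)$. Thus if $s_{i_1}\cdots s_{i_k}$ is a reduced expression for $w_0w$, and $D_0$ is the unique reduced pipe dream for $w_0$, in which every entry above the antidiagonal is a cross (that is, $D_0=\{(q,p)\mid q+p\le n\}$), then $$\mathcal{RP}(w)=\mathrm{mitosis}_{i_k}\cdots\mathrm{mitosis}_{i_1}(D_0).$$
   Context: Permutations: $\mathrm{length}(w)$ is the number of inversions, $s_i$ is the transposition of $i$ and $i+1$, $(ws_i)(k)=w(s_i(k))$, and $w_0=n\cdots321$ is the long permutation. Pipe dreams: a pipe dream is a finite subset $D$ of $\mathbb Z_{>0}\times\mathbb Z_{>0}$ (matrix-style indexing, row $i$, column $j$; all pipe dreams considered lie inside the $n\times n$ grid $[n]\times[n]$, and those in $\mathcal{RP}(w)$ are subsets of $\{(i,j)\mid i+j\le n\}$); the elements of $D$ are called crosses. Tile box $(i,j)$ by a cross if $(i,j)\in D$ (one pipe passes straight through horizontally, another vertically) and by an elbow joint otherwise (one pipe joins the west edge to the north edge, another joins the south edge to the east edge). This gives a network of pipes, each entering at the west end of a row and exiting at the north end of a column. $D$ is reduced if each pair of pipes crosses at most once. $\mathcal{RP}(w)$ is the set of reduced pipe dreams $D$ such that for every $i$ the pipe entering row $i$ exits from column $w(i)$. Mitosis: for a pipe dream $D$ in $[n]\times[n]$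 let $\mathrm{start}_i(D)=\min(\{j\mid(i,j)\notin D\}\cup\{n+1\})$ and $$\mathcal J_i(D)=\{j<\mathrm{start}_i(D)\mid (i+1,j)\notin D\}.$$ For $p\in\mathcal J_i(D)$, the offspring $D_p(i)$ is obtained from $D$ by first deleting the cross at $(i,p)$, and then moving each cross $(i,j)$ with $j\in\mathcal J_i(D)$, $j<p$, down to the empty box $(i+1,j)$. Set $\mathrm{mitosis}_i(D)=\{D_p(i)\mid p\in\mathcal J_i(D)\}$ (empty if $\mathcal J_i(D)$ is empty), and $\mathrm{mitosis}_i(\mathcal P)=\bigcup_{D\in\mathcal P}\mathrm{mitosis}_i(D)$ for a set $\mathcal P$ of pipe dreams. *)

(* Defs.v *)
From mathcomp Require Import all_boot all_fingroup.
From mathcomp Require Import boolp.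

Set Implicit Arguments.
Unset Strict Implicit.
Unset Printing Implicit Defensive.

(* Rows, columns and permutations are indexed from 0: the mathematical index  *)
(* k in {1, ..., n} is the element of 'I_n with value k - 1, and the index i  *)
(* of a simple transposition, in {1, ..., n-1}, is the element of 'I_n.-1     *)
(* with value i - 1.                                                          *)

Lemma next_row_subproof (n : nat) (i : 'I_n.-1) : i.+1 < n.
Proof. by case: n i => [|n] [i]. Qed.

Definition this_row (n : nat) (i : 'I_n.-1) : 'I_n := widen_ord (leq_pred n) i.
Definition next_row (n : nat) (i : 'I_n.-1) : 'I_n :=
  Ordinal (next_row_subproof i).

(* MathComp composes permutations from left to right; this is the product uv  *)
(* with (uv)(k) = u(v(k)).                                                    *)
Definition pmul (n : nat) (u v : 'S_n) : 'S_n := (v * u)%g.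

Definition simple (n : nat) (i : 'I_n.-1) : 'S_n :=
  tperm (this_row i) (next_row i).

Definition long_perm (n : nat) : 'S_n := perm (@rev_ord_inj n).

Definition perm_length (n : nat) (w : 'S_n) : nat :=
  #|[set x : 'I_n * 'I_n | (x.1 < x.2) && (w x.2 < w x.1)]|.

Definition word_prod (n : nat) (t : seq 'I_n.-1) : 'S_n :=
  foldr (fun i v => pmul (simple i) v) 1%g t.

Definition reduced_expression (n : nat) (t : seq 'I_n.-1) (v : 'S_n) : Prop :=
  word_prod t = v /\
  forall t' : seq 'I_n.-1, word_prod t' = v -> size t <= size t'.

Definition pipe_dream (n : nat) := {set 'I_n * 'I_n}.

(* All boxes of the infinite quadrant are tiled; those outside the n x n grid *)
(* carry elbows.                                                              *)
Definition cross (n : nat) (D : pipe_dream n) (r c : nat) : bool :=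
  [exists x in D, (x.1 == r :> nat) && (x.2 == c :> nat)].

Variant side := West | South.

(* enters D a r c d: the pipe that starts at the west end of row a comes into *)
(* box (r, c) through the side d of that box.                                 *)
Inductive enters (n : nat) (D : pipe_dream n) (a : nat) :
    nat -> nat -> side -> Prop :=
| EntersStart : enters D a a 0 West
| CrossEast r c :
    enters D a r c West -> cross D r c -> enters D a r c.+1 West
| CrossNorth r c :
    enters D a r.+1 c South -> cross D r.+1 c -> enters D a r c South
| ElbowNorth r c :
    enters D a r.+1 c West -> ~~ cross D r.+1 c -> enters D a r c South
| ElbowEast r c :
    enters D a r c South -> ~~ cross D r c -> enters D a r c.+1 West.

Definition exits (n : nat) (D : pipe_dream n) (a c : nat) : Prop :=
  (enters D a 0 c South /\ cross D 0 c) \/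
  (enters D a 0 c West /\ ~~ cross D 0 c).

Definition cross_at (n : nat) (D : pipe_dream n) (a b r c : nat) : Prop :=
  cross D r c /\
  ((enters D a r c West /\ enters D b r c South) \/
   (enters D a r c South /\ enters D b r c West)).

Definition reduced (n : nat) (D : pipe_dream n) : Prop :=
  forall a b r c r' c' : nat, a <> b ->
    cross_at D a b r c -> cross_at D a b r' c' -> r = r' /\ c = c'.

Definition staircase (n : nat) : pipe_dream n :=
  [set x : 'I_n * 'I_n | x.1.+1 + x.2.+1 <= n].

(* The condition D \subset staircase n is needed because only the pipes from  *)
(* the first n rows are constrained: a cross at the second diagonal box of a  *)
(* 2 x 2 grid exchanges the pipes 3 and 4 only.                               *)
Definition RP (n : nat) (w : 'S_n) : {set pipe_dream n} :=
  [set D : pipe_dream n |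
    `[< [/\ D \subset staircase n, reduced D
          & forall i : 'I_n, exits D i (w i)] >]].

(* Columns run over 0, ..., n-1, so the default value of the minimum is n.    *)
Definition start (n : nat) (i : 'I_n) (D : pipe_dream n) : nat :=
  \big[minn/n]_(j < n | (i, j) \notin D) j.

Definition mitosis_cols (n : nat) (i : 'I_n.-1) (D : pipe_dream n) :
    {set 'I_n} :=
  [set j : 'I_n | (j < start (this_row i) D) && ((next_row i, j) \notin D)].

Definition offspring (n : nat) (i : 'I_n.-1) (D : pipe_dream n) (p : 'I_n) :
    pipe_dream n :=
  let moved := [set j in mitosis_cols i D | j < p] in
  ((D :\ (this_row i, p)) :\: [set (this_row i, j) | j in moved])
    :|: [set (next_row i, j) | j in moved].

Definition mitosis (n : nat) (i : 'I_n.-1) (D : pipe_dream n) :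
    {set pipe_dream n} :=
  [set offspring i D p | p in mitosis_cols i D].

Definition mitosis_set (n : nat) (i : 'I_n.-1) (P : {set pipe_dream n}) :
    {set pipe_dream n} :=
  \bigcup_(D in P) mitosis i D.

(* Main.v *)
(* Passing from D to its offspring E at the cross (i, p) only changes the     *)
(* first p + 1 boxes of two rows, and following the pipes through these boxes *)
(* shows that the pipes of E are those of D with the labels i and i + 1       *)
(* exchanged, the crossings of E being those of D except one of these two     *)
(* pipes. Hence E belongs to w s_i when D belongs to w. Conversely, given a   *)
(* reduced E for w s_i, let (i + 1, p) be the first elbow of the row i + 1.   *)
(* A cross at (i, p) would make the pipe i + 1 cross the pipe i, or cross     *)
(* some pipe twice; so (i, p) is an elbow, and E is the offspring of a unique *)
(* D at (i, p). Reducedness is preserved in this direction because i and      *)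
(* i + 1 do not cross in E. For w_0 all pairs of pipes cross, which forces    *)
(* the whole staircase; for the other permutations one follows a reduced      *)
(* word, each letter of which is a descent by the exchange condition.         *)

Require Import Defs.
From mathcomp Require Import all_boot all_fingroup.
From mathcomp Require Import boolp zify.

Set Implicit Arguments.
Unset Strict Implicit.
Unset Printing Implicit Defensive.

(** Each edge of the tiling is labelled by the row where its pipe starts ([west], [north]), so the
    permutation is read off the top row ([exitsP]). Sweeping the boxes from the bottom row up turns
    a pipe dream into a word of adjacent transpositions of positions ([pos]), and reducedness
    becomes a condition local to each cross: the pipe from the west has the smaller label
    ([reducedP]).

    Mitosis is recast as the relation [is_offspring], which can be read from parent to child and
    back. Along it the labels change by the exchange of i and i + 1 ([offspring_north],
    [offspring_outside]), so permutation and reducedness pass in both directions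
    ([offspring_reduced], [parent_reduced]). A parent exists by [first_elbow] and [parent_exists],
    and is unique by [parent_uniq]; hence [RP_pmul_simple] and the disjointness. Iteration starts
    from [RP_long_perm], and [word_exchange] shows that each letter of a reduced word is a
    legitimate step ([RP_reduced_word]). *)

Definition adj_swap (k u : nat) : nat :=
  if u == k then k.+1 else if u == k.+1 then k else u.

Ltac swap_lia := rewrite /adj_swap; repeat (case: eqP => ?); lia.

Lemma adj_swapK k : involutive (adj_swap k).
Proof.
move=> u; rewrite /adj_swap; have [->|neq_uk] := eqVneq u k.
  by rewrite eqxx gtn_eqF.
by have [->|/negPf->] := eqVneq u k.+1; rewrite ?eqxx // (negPf neq_uk).
Qed.

Lemma adj_swap_id k u : k.+1 < u -> adj_swap k u = u.
Proof. swap_lia. Qed.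

Lemma adj_swap_lt k u v :
  u < v -> ~ (u = k /\ v = k.+1) -> adj_swap k u < adj_swap k v.
Proof. swap_lia. Qed.

Lemma crossE n (D : pipe_dream n) (i j : 'I_n) : cross D i j = ((i, j) \in D).
Proof.
apply/existsP/idP => [[[a b]] /andP[Dab /andP[/eqP/= ea /eqP/= eb]]|Dij].
  by rewrite -(val_inj ea) -(val_inj eb).
by exists (i, j); rewrite Dij !eqxx.
Qed.

Lemma crossP n (D : pipe_dream n) (r c : nat) :
  reflect (exists2 x, x \in D & r = x.1 /\ c = x.2) (cross D r c).
Proof.
apply: (iffP existsP) => [[x /and3P[Dx /eqP <- /eqP <-]]|[x Dx [-> ->]]].
  by exists x.
by exists x; rewrite Dx !eqxx.
Qed.

Lemma cross_lt n (D : pipe_dream n) r c : cross D r c -> r < n /\ c < n.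
Proof. by case/crossP => x _ [-> ->]. Qed.

Lemma cross_inj n (D E : pipe_dream n) : cross D =2 cross E -> D = E.
Proof. by move=> DE; apply/setP => -[i j]; rewrite -!crossE. Qed.

Lemma row_ind n (P : nat -> Prop) :
  (forall r, n <= r -> P r) -> (forall r, P r.+1 -> P r) -> forall r, P r.
Proof.
move=> P_out P_step r; have [|lt_rn] := leqP n r; first exact: P_out.
have: P (r + (n - r)) by apply: P_out; lia.
elim: (n - r) => [|k IHk]; first by rewrite addn0.
by rewrite addnS => /P_step.
Qed.

(** * Labels of the pipes on the edges of the tiling *)

Fixpoint west_from n (D : pipe_dream n) (r : nat) (s : nat -> nat) (c : nat) :=
  if c is c'.+1 then
    if cross D r c' then west_from D r s c' else s c'
  else r.

(** The recursion descends through increasing rows, so the number [k] of rows left in the grid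
    serves as fuel. *)
Fixpoint north_fuel n (D : pipe_dream n) (k r c : nat) : nat :=
  if k is k'.+1 then
    let s := north_fuel D k' r.+1 in
    if cross D r c then s c else west_from D r s c
  else r + c.

(* [north D r c] is the row of origin of the pipe on the north side of the    *)
(* box (r, c), and [north D r.+1 c] that of the pipe on its south side; below *)
(* the grid the pipes run along antidiagonals.                                *)
Definition north n (D : pipe_dream n) (r : nat) : nat -> nat :=
  north_fuel D (n - r) r.

Definition west n (D : pipe_dream n) (r : nat) : nat -> nat :=
  west_from D r (north D r.+1).

Arguments north : simpl never.
Arguments west : simpl never.

Lemma west0 n (D : pipe_dream n) r : west D r 0 = r.
Proof. by []. Qed.

Lemma westS n (D : pipe_dream n) r c :
  west D r c.+1 = if cross D r c then west D r c else north D r.+1 c.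
Proof. by []. Qed.

Lemma cross_out n (D : pipe_dream n) r c :
  (n <= r) || (n <= c) -> cross D r c = false.
Proof. by case X: (cross D r c) => //; have := cross_lt X; lia. Qed.

Lemma north_out n (D : pipe_dream n) r c : n <= r -> north D r c = r + c.
Proof. by rewrite /north -subn_eq0 => /eqP->. Qed.

Lemma west_out n (D : pipe_dream n) r c : n <= r -> west D r c = r + c.
Proof.
move=> le_nr; elim: c => [|c IHc]; first by rewrite west0 addn0.
by rewrite westS cross_out ?le_nr // north_out; lia.
Qed.

Lemma northE n (D : pipe_dream n) r c :
  north D r c = if cross D r c then north D r.+1 c else west D r c.
Proof.
have [le_nr|lt_rn] := leqP n r.
  by rewrite north_out // cross_out ?le_nr // west_out.
by rewrite /west {1 2}/north -(subnSK lt_rn).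
Qed.

(** Pipes travel only north and east. *)
Lemma north_ge n (D : pipe_dream n) r c : r <= north D r c.
Proof.
move: r c; apply: (@row_ind n (fun r => forall c, r <= north D r c)).
  by move=> r le_nr c; rewrite north_out ?leq_addr.
move=> r IHr; have geW c : r <= west D r c.
  by elim: c => // c IHc; rewrite westS; case: ifP => // _; apply/ltnW/IHr.
by move=> c; rewrite northE; case: ifP => // _; apply/ltnW/IHr.
Qed.

Definition label n (D : pipe_dream n) (r c : nat) (d : side) : nat :=
  if d is West then west D r c else north D r.+1 c.

(** Each edge lies on exactly one pipe. For the converse, an edge is traced back along its pipe, the
    region below the grid, where there are only elbows, being the base case. *)
Lemma entersP n (D : pipe_dream n) a r c d :
  enters D a r c d <-> label D r c d = a.
Proof.
split=> [|<-].
  elim=> {r c d} [//|r c _ <- X|r c _ <- X|r c _ <- /negPf X|r c _ <- /negPf X].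
  - by rewrite /label westS X.
  - by rewrite /label [LHS]northE X.
  - by rewrite /label northE X.
  - by rewrite /label westS X.
have: forall c, enters D (west D r c) r c West /\
    enters D (north D r.+1 c) r c South.
  move: r {c d}; apply: (@row_ind n) => [r le_nr c|r IHr c].
    elim: c r le_nr => [|c IHc] r le_nr.
      split; first exact: EntersStart.
      apply: ElbowNorth; last by rewrite cross_out ?leqW.
      rewrite (_ : north D r.+1 0 = r.+1); first exact: EntersStart.
      by rewrite north_out ?addn0 ?leqW.
    have W r' : n <= r' -> enters D (west D r' c.+1) r' c.+1 West.
      move=> le_nr'; have out: ~~ cross D r' c by rewrite cross_out ?le_nr'.
      rewrite westS (negPf out); apply: ElbowEast => //.
      by case: (IHc r').
    split; first exact: W.
    have out: ~~ cross D r.+1 c.+1 by rewrite cross_out //; lia.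
    by rewrite northE (negPf out); apply: ElbowNorth => //; apply: W;
      apply: leqW.
  have S c' : enters D (north D r.+1 c') r c' South.
    rewrite northE; case: ifPn => X.
      by apply: CrossNorth => //; case: (IHr c').
    by apply: ElbowNorth => //; case: (IHr c').
  split=> //; elim: c => [|c IHc]; first exact: EntersStart.
  by rewrite westS; case: ifPn => X; [apply: CrossEast | apply: ElbowEast].
by move=> /(_ c)[]; case: d.
Qed.

Lemma exitsP n (D : pipe_dream n) a c : exits D a c <-> north D 0 c = a.
Proof.
rewrite northE /exits !entersP /=; case: ifP => _.
  by split=> [[[-> _]|[_ //]]|->]; [|left].
by split=> [[[_ //]|[-> _]]|->]; [|right].
Qed.

Lemma cross_atP n (D : pipe_dream n) a b r c :
  cross_at D a b r c <->
  cross D r c /\ ((west D r c = a /\ north D r.+1 c = b) \/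
                  (west D r c = b /\ north D r.+1 c = a)).
Proof. rewrite /cross_at !entersP /=; tauto. Qed.

(** * Positions of the pipes along a sweeping boundary *)

Fixpoint pos_row n (D : pipe_dream n) (r : nat) (q : nat -> nat) (c a : nat) :=
  if c is c'.+1 then
    let u := pos_row D r q c' a in
    if cross D r c' then adj_swap (r + c') u else u
  else q a.

Fixpoint pos_fuel n (D : pipe_dream n) (k r a : nat) : nat :=
  if k is k'.+1 then pos_row D r (pos_fuel D k' r.+1) n a else a.

(* Read the boxes row by row from the bottom, each row from west to east. The *)
(* boundary of the region read so far meets every pipe once, in the order of  *)
(* the positions 0, 1, 2, ... from the north-west to the south-east; an elbow *)
(* in the box (r, c) leaves the order unchanged and a cross exchanges the     *)
(* positions r + c and r + c + 1. [pos D r c a] is the position of the pipe a *)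
(* just before the box (r, c) is read.                                        *)
Definition pos n (D : pipe_dream n) (r : nat) : nat -> nat -> nat :=
  pos_row D r (pos_fuel D (n - r.+1) r.+1).

Lemma posS n (D : pipe_dream n) r c a :
  pos D r c.+1 a =
    if cross D r c then adj_swap (r + c) (pos D r c a) else pos D r c a.
Proof. by []. Qed.

Lemma pos_out n (D : pipe_dream n) r c a : n <= r -> pos D r c a = a.
Proof.
move=> le_nr; elim: c => [|c IHc]; last by rewrite posS cross_out ?le_nr.
by rewrite /pos /= (eqP (leqW le_nr : n - r.+1 == 0)).
Qed.

Lemma pos0 n (D : pipe_dream n) r a : pos D r 0 a = pos D r.+1 n a.
Proof.
have [le_nr|lt_rn] := leqP n r.+1.
  by rewrite [RHS]pos_out // /pos /= (eqP (le_nr : n - r.+1 == 0)).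
by rewrite /pos /= -(subnSK lt_rn).
Qed.

Lemma box_ind n (P : nat -> nat -> Prop) :
    (forall r c, n <= r -> P r c) -> (forall r, P r.+1 n -> P r 0) ->
    (forall r c, P r c -> P r c.+1) ->
  forall r c, P r c.
Proof.
move=> P_out P_row P_box; apply: (@row_ind n) => [r le_nr c|r IHr c].
  exact: P_out.
by elim: c => [|c]; [apply: P_row | apply: P_box].
Qed.

Lemma pos_inj n (D : pipe_dream n) r c : injective (pos D r c).
Proof.
move: r c; apply: (@box_ind n) => [r c le_nr|r IH|r c IH] a b.
- by rewrite !pos_out.
- by rewrite !pos0; apply: IH.
- by rewrite !posS; case: (cross D _ _); [move/(can_inj (adj_swapK _))|];
    apply: IH.
Qed.

Lemma pos_above n (D : pipe_dream n) r c a : a < r -> pos D r c a = a.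
Proof.
move: r c; apply: (@box_ind n) => [r c /pos_out //|r IH lt_ar|r c IH lt_ar].
  by rewrite pos0 IH // ltnW.
by rewrite posS IH //; case: ifP => // _; swap_lia.
Qed.

Lemma pos_stable_left n (D : pipe_dream n) r c c' a :
  pos D r c a < r + c -> c <= c' -> pos D r c' a = pos D r c a.
Proof.
move=> lt_pos /subnKC <-; elim: (c' - c) => [|k IHk]; first by rewrite addn0.
by rewrite addnS posS IHk; case: ifP => // _; swap_lia.
Qed.

Lemma pos_stable_right n (D : pipe_dream n) r c a :
  r + c < pos D r 0 a -> pos D r c a = pos D r 0 a.
Proof.
elim: c => // c IHc lt_pos; have IH := IHc ltac:(lia).
by rewrite posS IH; case: ifP => // _; swap_lia.
Qed.

Lemma pos_out_col n (D : pipe_dream n) r c a :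
  n <= c -> pos D r c a = pos D r n a.
Proof.
move/subnKC <-; elim: (c - n) => [|k IHk]; first by rewrite addn0.
by rewrite addnS posS cross_out ?leq_addr ?orbT.
Qed.

(** Once the box (r + 1, c) is read, the pipe on its north side is at position r + c + 1. The later
    boxes of that row act on larger positions, and the boxes of the row r before column c on smaller
    ones. *)
Lemma pos_label n (D : pipe_dream n) r c :
  pos D r c (west D r c) = r + c /\ pos D r c (north D r.+1 c) = (r + c).+1.
Proof.
move: r c; apply: (@row_ind n) => [r le_nr c|r IHr c].
  by rewrite !pos_out // west_out // north_out ?leqW.
have S c' : pos D r c' (north D r.+1 c') = (r + c').+1.
  have pos1: pos D r.+1 c'.+1 (north D r.+1 c') = (r + c').+1.
    rewrite posS northE; case: (cross D _ _); last by rewrite (IHr c').1.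
    by rewrite (IHr c').2; swap_lia.
  have posn: pos D r 0 (north D r.+1 c') = (r + c').+1.
    rewrite pos0; have [le_nc|lt_cn] := leqP n c'.+1.
      by rewrite -pos1 pos_out_col.
    by rewrite (pos_stable_left _ (ltnW lt_cn)) pos1 //; lia.
  by rewrite pos_stable_right posn.
split=> //; elim: c => [|c IHc]; first by rewrite west0 pos0 pos_above ?addn0.
rewrite westS posS; case: (cross D _ _); last by rewrite S; lia.
by rewrite IHc; swap_lia.
Qed.

Lemma pos_west n (D : pipe_dream n) r c a :
  pos D r c a = r + c -> a = west D r c.
Proof. by have [<- _] := pos_label D r c => /pos_inj. Qed.

Lemma pos_south n (D : pipe_dream n) r c a :
  pos D r c a = (r + c).+1 -> a = north D r.+1 c.
Proof. by have [_ <-] := pos_label D r c => /pos_inj. Qed.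

Lemma pos_top n (D : pipe_dream n) c : c < n -> pos D 0 n (north D 0 c) = c.
Proof.
move=> lt_cn; have pos1: pos D 0 c.+1 (north D 0 c) = c.
  have [posW posS'] := pos_label D 0 c.
  rewrite posS northE; case: (cross D _ _); last by rewrite posW.
  by rewrite posS'; swap_lia.
by rewrite (pos_stable_left _ lt_cn) pos1.
Qed.

(** * Reducedness as a local condition *)

(* Two pipes that have crossed once cross a second time with their roles      *)
(* exchanged, so that reducedness can be tested one cross at a time.          *)
Definition ascending n (D : pipe_dream n) : Prop :=
  forall r c, cross D r c -> west D r c < north D r.+1 c.

(** Pipes start in the order of their labels, and two of them change order only where they cross
    each other. The box found is the last one at which the pair became inverted. *)
Lemma inverted_cross n (D : pipe_dream n) x y r c :
    x < y -> pos D r c y < pos D r c x ->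
  exists r' c', [/\ (r < r') || (r == r') && (c' < c), cross D r' c',
    west D r' c' = x & north D r'.+1 c' = y].
Proof.
move=> lt_xy; move: r c; apply: (@box_ind n) => [r c le_nr|r IH|r c IH].
- by rewrite !pos_out // ltnNge ltnW.
- rewrite !pos0 => /IH[r' [c' [lt_t X Wx Sy]]]; exists r', c'; split=> //.
  by apply/orP; left; case/orP: lt_t; lia.
- rewrite !posS => inv;
    case: (ltngtP (pos D r c y) (pos D r c x)) => [|lt_pos|eq_pos].
  + case/IH => r' [c' [lt_t X Wx Sy]]; exists r', c'; split=> //.
    by case/orP: lt_t; lia.
  + case X: (cross D r c) inv; last by lia.
    move=> inv.
    case: (pselect (pos D r c x = r + c /\ pos D r c y = (r + c).+1)).
      case=> /pos_west eq_x /pos_south eq_y.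
      by exists r, c; rewrite eqxx ltnSn orbT.
    by move/(adj_swap_lt lt_pos); lia.
  + by move: lt_xy; rewrite (pos_inj eq_pos) ltnn.
Qed.

(** To undo an inversion, the pipe with the larger label would have to enter a cross from the
    west. *)
Lemma ascending_inverted n (D : pipe_dream n) x y r c r' c' :
    ascending D -> x < y -> c <= n -> (r' < r) || (r == r') && (c <= c') ->
  pos D r c y < pos D r c x -> pos D r' c' y < pos D r' c' x.
Proof.
move=> ascD lt_xy le_cn later inv.
have step s d : pos D s d y < pos D s d x -> pos D s d.+1 y < pos D s d.+1 x.
  move=> inv_sd; rewrite !posS; case X: (cross D s d) => //.
  apply: (adj_swap_lt inv_sd) => -[/pos_west eq_y /pos_south eq_x].
  by have := ascD _ _ X; rewrite -eq_y -eq_x; lia.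
have steps s d d' : d <= d' -> pos D s d y < pos D s d x ->
    pos D s d' y < pos D s d' x.
  move=> /subnKC <- inv_sd.
  by elim: (d' - d) => [|k IHk]; rewrite ?addn0 // addnS; apply: step.
case/orP: later => [lt_r|/andP[/eqP <- le_c]]; last exact: steps inv.
(* [k] counts the rows climbed; truncated subtraction stalls at the row 0. *)
have rows k : pos D (r - k) n y < pos D (r - k) n x.
  elim: k => [|k IHk]; first by rewrite subn0; apply: steps inv.
  have [le_rk|lt_kr] := leqP r k.
    by rewrite (_ : r - k.+1 = r - k) //; lia.
  by apply: (@steps _ 0) => //; rewrite !pos0 subnSK.
apply: (@steps _ 0) => //; rewrite !pos0.
by rewrite (_ : r'.+1 = r - (r - r'.+1)) //; lia.
Qed.

Lemma ascending_cross n (D : pipe_dream n) r c r' c' :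
    ascending D -> cross D r c -> (r' < r) || (r == r') && (c < c') ->
  pos D r' c' (north D r.+1 c) < pos D r' c' (west D r c).
Proof.
move=> ascD X later; have [_ lt_cn] := cross_lt X.
apply: (@ascending_inverted _ _ _ _ r c.+1) => //; first exact: ascD.
have [posW posS'] := pos_label D r c.
by rewrite !posS X posW posS'; swap_lia.
Qed.

Lemma ascending_later n (D : pipe_dream n) r c r' c' :
    ascending D -> cross D r c -> cross D r' c' ->
    (r' < r) || (r == r') && (c < c') ->
    west D r c = west D r' c' -> north D r.+1 c = north D r'.+1 c' -> False.
Proof.
move=> ascD X X' later eqW eqN; have := ascending_cross ascD X later.
by have [posW posS'] := pos_label D r' c'; rewrite eqW eqN posW posS'; lia.
Qed.

(** A cross with labels in the wrong order is preceded by a cross of the same two pipes in the right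
    order. Conversely, a pair that has crossed in the right order stays inverted, hence cannot do so
    again. *)
Lemma reducedP n (D : pipe_dream n) : reduced D <-> ascending D.
Proof.
split=> [redD r c X|ascD a b r c r' c' neq_ab
  /cross_atP[X lab] /cross_atP[X' lab']].
  rewrite ltnNge leq_eqVlt; apply/norP; split.
    apply/eqP => eqWS; have [] := pos_label D r c.
    by rewrite eqWS => ->; lia.
  apply/negP => lt_SW; have [posW posS'] := pos_label D r c.
  have inv: pos D r c (west D r c) < pos D r c (north D r.+1 c).
    by rewrite posW posS'.
  have [r' [c' [lt_t X' eqW eqS]]] := inverted_cross lt_SW inv.
  have [| | |] := redD (north D r.+1 c) (west D r c) r c r' c'; first by lia.
  - by apply/cross_atP; split=> //; right.
  - by apply/cross_atP; split=> //; left.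
  - by case/orP: lt_t; lia.
have lt := ascD _ _ X; have lt' := ascD _ _ X'.
have [eqW eqN]: west D r c = west D r' c' /\ north D r.+1 c = north D r'.+1 c'.
  by lia.
have [lt_r|lt_r|eq_r] := ltngtP r r'.
- by case: (ascending_later ascD X' X _ (esym eqW) (esym eqN)); lia.
- by case: (ascending_later ascD X X' _ eqW eqN); lia.
have [lt_c|lt_c|//] := ltngtP c c'.
- by case: (ascending_later ascD X X' _ eqW eqN); lia.
- by case: (ascending_later ascD X' X _ (esym eqW) (esym eqN)); lia.
Qed.

(** * Effect of mitosis on the labels *)

Lemma west_rename n (D E : pipe_dream n) (f : nat -> nat) r :
    f r = r -> cross D r =1 cross E r ->
    (forall c, north E r.+1 c = f (north D r.+1 c)) ->
  forall c, west E r c = f (west D r c).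
Proof.
move=> fr eqX eqN; elim=> [|c IHc]; first by rewrite !west0.
by rewrite !westS eqX; case: ifP.
Qed.

Lemma north_rename n (D E : pipe_dream n) (f : nat -> nat) r :
    f r = r -> cross D r =1 cross E r ->
    (forall c, north E r.+1 c = f (north D r.+1 c)) ->
  forall c, north E r c = f (north D r c).
Proof.
move=> fr eqX eqN c; rewrite [LHS]northE [in RHS]northE eqX.
by case: ifP => // _; apply: west_rename.
Qed.

Lemma eq_north n (D E : pipe_dream n) r :
  (forall r', r <= r' -> cross D r' =1 cross E r') -> north E r =1 north D r.
Proof.
move: r; apply: (@row_ind n) => [r le_nr _ c|r IHr eqX].
  by rewrite !north_out.
apply: (@north_rename _ _ _ id) => //; first exact: eqX.
by apply: IHr => r' lt_rr'; apply/eqX/ltnW.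
Qed.

(* A box-by-box description of the offspring [E] of [D] at the cross (i, p)   *)
(* that can be read in both directions: [p] is the first elbow of the row     *)
(* i + 1 of [E], and [D] is then determined by [E].                           *)
Record is_offspring n (i p : nat) (D E : pipe_dream n) : Prop := IsOffspring {
  offspring_rows : forall r c, r != i -> r != i.+1 -> cross D r c = cross E r c;
  offspring_right : forall r c, p < c -> cross D r c = cross E r c;
  offspring_parent_top : forall c, c <= p -> cross D i c;
  offspring_parent_end : ~~ cross D i.+1 p;
  offspring_bottom : forall c, c < p -> cross E i.+1 c;
  offspring_moved : forall c, c < p -> cross E i c = cross D i.+1 c;
  offspring_end_top : ~~ cross E i p;
  offspring_end_bottom : ~~ cross E i.+1 p }.

Lemma offspring_south n i p (D E : pipe_dream n) :
  is_offspring i p D E -> north E i.+2 =1 north D i.+2.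
Proof.
by case=> rows *; apply: eq_north => r' lt_r' c; apply: rows; lia.
Qed.

Lemma offspring_west_bottom n i p (D E : pipe_dream n) c :
  is_offspring i p D E -> c <= p -> west E i.+1 c = i.+1.
Proof.
move=> off; elim: c => // c IHc lt_cp.
by rewrite westS (offspring_bottom off) // IHc // ltnW.
Qed.

Lemma parent_west_top n i p (D E : pipe_dream n) c :
  is_offspring i p D E -> c <= p.+1 -> west D i c = i.
Proof.
move=> off; elim: c => // c IHc le_cp.
by rewrite westS (offspring_parent_top off) // IHc // ltnW.
Qed.

Lemma offspring_south_top n i p (D E : pipe_dream n) c :
  is_offspring i p D E -> c < p -> north E i.+1 c = north D i.+2 c.
Proof.
by move=> off lt_cp;
  rewrite northE (offspring_bottom off) // (offspring_south off).
Qed.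

(** The first p boxes of the row i of [E] copy those of the row i + 1 of [D] and receive the same
    pipes from the south, with labels at least i + 2. Only the pipe entering from the west
    differs. *)
Lemma offspring_west_top n i p (D E : pipe_dream n) c :
  is_offspring i p D E -> c <= p ->
  west E i c = adj_swap i (west D i.+1 c).
Proof.
move=> off; elim: c => [|c IHc] le_cp; first by rewrite !west0; swap_lia.
rewrite !westS (offspring_moved off) //; case: ifP => _; first exact/IHc/ltnW.
by rewrite (offspring_south_top off) // adj_swap_id // north_ge.
Qed.

Lemma offspring_bottom_right n i p (D E : pipe_dream n) c :
    is_offspring i p D E -> p < c ->
  west E i.+1 c = west D i.+1 c /\ i.+1 < west D i.+1 c.
Proof.
move=> off; elim: c => // c IHc; rewrite ltnS leq_eqVlt => /predU1P[<-|lt_pc].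
  rewrite !westS (negPf (offspring_end_bottom off)).
  rewrite (negPf (offspring_parent_end off)) (offspring_south off).
  by split=> //; apply: north_ge.
rewrite !westS (offspring_right off) // (offspring_south off).
by case: ifP => _; [apply: IHc | split=> //; apply: north_ge].
Qed.

Lemma offspring_south_right n i p (D E : pipe_dream n) c :
    is_offspring i p D E -> p < c ->
  north E i.+1 c = adj_swap i (north D i.+1 c).
Proof.
move=> off lt_pc; have [eqW gtW] := offspring_bottom_right off lt_pc.
rewrite [LHS]northE [in RHS]northE (offspring_right off) // (offspring_south
  off).
by case: ifP => _; rewrite adj_swap_id // north_ge.
Qed.

Lemma offspring_west_right n i p (D E : pipe_dream n) c :
  is_offspring i p D E -> p < c -> west E i c = adj_swap i (west D i c).
Proof.
move=> off; elim: c => // c IHc; rewrite ltnS leq_eqVlt => /predU1P[<-|lt_pc].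
  (* At column p the pipe i + 1, straight along its row in [E] so far, turns north and then east,
     taking the place of the pipe i. *)
  rewrite (parent_west_top off) // westS (negPf (offspring_end_top off)).
  rewrite northE (negPf (offspring_end_bottom off)).
  by rewrite (offspring_west_bottom off) //; swap_lia.
rewrite !westS (offspring_right off) // (offspring_south_right off) //.
by case: ifP => _ //; apply: IHc.
Qed.

(** The exchange produced by the two rows is carried through the rows above, which have the same
    crosses and whose own pipes have labels below i. *)
Lemma offspring_north n i p (D E : pipe_dream n) r c :
  is_offspring i p D E -> r <= i -> north E r c = adj_swap i (north D r c).
Proof.
move=> off le_ri; rewrite -(subKn le_ri); elim: (i - r) c => [|k IHk] c.
  rewrite subn0 [LHS]northE [in RHS]northE.
  case: (ltngtP c p) => [lt_cp|lt_pc|->].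
  - rewrite (offspring_parent_top off) ?(ltnW lt_cp) // [in RHS]northE.
    rewrite (offspring_moved off) // (offspring_south_top off) //.
    case: ifP => _; first by rewrite adj_swap_id // north_ge.
    exact/(offspring_west_top off)/ltnW.
  - rewrite (offspring_right off) //; case: ifP => _.
      exact: offspring_south_right off _.
    exact: offspring_west_right off _.
  - rewrite (offspring_parent_top off) // [in RHS]northE.
    rewrite (negPf (offspring_end_top off)) (negPf (offspring_parent_end off)).
    exact: offspring_west_top off _.
have [le_ik|lt_ki] := leqP i k.
  by rewrite (_ : i - k.+1 = i - k) //; lia.
apply: north_rename => [|c'|c']; first by swap_lia.
  by apply: (offspring_rows off); lia.
by rewrite subnSK.
Qed.

Lemma offspring_west n i p (D E : pipe_dream n) r c :
  is_offspring i p D E -> r < i -> west E r c = adj_swap i (west D r c).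
Proof.
move=> off lt_ri; apply: west_rename => [|c'|c']; first by swap_lia.
  by apply: (offspring_rows off); lia.
exact: offspring_north off _.
Qed.

(** * Reducedness of offspring and parents *)

(* The pipe i runs straight through the boxes (i, 0), ..., (i, p), and the    *)
(* pipe i + 1 turns north at the first elbow of the row below.                *)
Lemma parent_cross n i p (D E : pipe_dream n) :
    is_offspring i p D E ->
  exists2 q, q <= p & cross_at D i i.+1 i q.
Proof.
move=> off.
have at_elbow q : q <= p -> west D i.+1 q = i.+1 -> ~~ cross D i.+1 q ->
    cross_at D i i.+1 i q.
  move=> le_qp eqW X; apply/cross_atP; split.
    exact: offspring_parent_top off _ _.
  by left; rewrite northE (negPf X) eqW (parent_west_top off) // leqW.
have early c : c <= p ->
    west D i.+1 c = i.+1 \/ exists2 q, q <= p & cross_at D i i.+1 i q.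
  elim: c => [|c IHc] lt_cp; first by left.
  have [eqW|] := IHc (ltnW lt_cp); last by right.
  rewrite westS; case: ifPn => [_|X]; first by left.
  by right; exists c; [apply: ltnW | apply: at_elbow (ltnW lt_cp) eqW X].
have [eqW|//] := early p (leqnn p).
by exists p => //; apply: at_elbow eqW (offspring_parent_end off).
Qed.

(* Outside the boxes changed by mitosis, the pipes i and i + 1 do not occur   *)
(* below the row i, so that their exchange is the identity there.             *)
Definition relabel (i r : nat) : nat -> nat :=
  if r <= i then adj_swap i else id.

Lemma offspring_outside n i p (D E : pipe_dream n) r c :
    is_offspring i p D E -> (r != i) && (r != i.+1) || (p < c) ->
  [/\ cross E r c = cross D r c, west E r c = relabel i r (west D r c)
    & north E r.+1 c = relabel i r (north D r.+1 c)].
Proof.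
move=> off out; split; first case/orP: out => [/andP[neq_i neq_i1]|lt_pc].
- by rewrite (offspring_rows off).
- by rewrite (offspring_right off).
- rewrite /relabel; case: (ltngtP r i) out => [lt_ri _|lt_ir|-> /= lt_pc].
  + exact: offspring_west off _.
  + have [-> /= lt_pc|neq_ri1 _] := eqVneq r i.+1.
      by case: (offspring_bottom_right off lt_pc).
    apply: (@west_rename _ _ _ id) => [//|c'|c'].
      by apply: (offspring_rows off); lia.
    by apply: eq_north => r' lt_r' c''; apply: (offspring_rows off); lia.
  + exact: offspring_west_right off _.
- rewrite /relabel; case: (ltngtP r i) out => [lt_ri _|lt_ir|-> /= lt_pc].
  + exact: offspring_north off _.
  + by move=> _; apply: eq_north => r' lt_r' c'; apply: (offspring_rows off);
      lia.
  + exact: offspring_south_right off _.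
Qed.

Lemma relabel_lt i r x y :
  x < y -> ~ (x = i /\ y = i.+1) -> relabel i r x < relabel i r y.
Proof. by rewrite /relabel; case: ifP => // _; apply: adj_swap_lt. Qed.

Lemma relabelK i r : involutive (relabel i r).
Proof. by rewrite /relabel; case: ifP => // _; apply: adj_swapK. Qed.

Lemma inside_or_outside i p r c :
  [\/ r = i /\ c <= p, r = i.+1 /\ c <= p |
     (r != i) && (r != i.+1) || (p < c)].
Proof.
have [le_cp|lt_pc] := leqP c p; last by rewrite orbT; constructor 3.
have [->|neq_i] := eqVneq r i; first by constructor 1.
by have [->|neq_i1] := eqVneq r i.+1; [constructor 2 | constructor 3].
Qed.

(** The exchange keeps the order of any two labels except i and i + 1, and these have their only
    crossing of [D] among the boxes that mitosis changes. *)
Lemma offspring_reduced n i p (D E : pipe_dream n) :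
  is_offspring i p D E -> reduced D -> reduced E.
Proof.
move=> off redD; have ascD : ascending D by apply/reducedP.
apply/reducedP => r c X;
  case: (inside_or_outside i p r c) X => [[-> le_cp]|[-> le_cp]|out].
- have [->|neq_cp] := eqVneq c p;
    first by rewrite (negPf (offspring_end_top off)).
  have lt_cp : c < p by lia.
  rewrite (offspring_moved off) // => X.
  rewrite (offspring_west_top off) // (offspring_south_top off) //.
  rewrite -(@adj_swap_id i (north D i.+2 c)) ?north_ge //.
  apply: adj_swap_lt; first exact: ascD.
  by have := north_ge D i.+2 c; lia.
- move=> _; rewrite (offspring_west_bottom off) //; exact: north_ge.
- have [-> -> ->] := offspring_outside off out => X.
  apply: relabel_lt; first exact: ascD.
  case=> eqW eqN; have [q le_qp Xq] := parent_cross off.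
  have Xr : cross_at D i i.+1 r c by apply/cross_atP; split=> //; left.
  by have := redD i i.+1 r c i q ltac:(lia) Xr Xq; lia.
Qed.

(** The same comparison backwards. An ascending cross of i and i + 1 in [E] would leave them
    inverted at the top, against the hypothesis on their final positions. *)
Lemma parent_reduced n i p (D E : pipe_dream n) :
    is_offspring i p D E -> reduced E -> pos E 0 n i < pos E 0 n i.+1 ->
  reduced D.
Proof.
move=> off /reducedP ascE lt_pos; apply/reducedP => r c.
case: (inside_or_outside i p r c) => [[-> le_cp]|[-> le_cp]|out].
- by move=> _; rewrite (parent_west_top off) ?leqW //; exact: north_ge.
- have [->|neq_cp] := eqVneq c p;
    first by rewrite (negPf (offspring_parent_end off)).
  have lt_cp : c < p by lia.
  rewrite -(offspring_moved off) // => /ascE.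
  rewrite (offspring_west_top off) // (offspring_south_top off) // => lt_WN.
  rewrite -(adj_swapK i (west _ _ _)) -(@adj_swap_id i (north _ _ _)) ?north_ge
    //.
  by apply: adj_swap_lt => //; have := north_ge D i.+2 c; lia.
- have [eqX eqW eqN] := offspring_outside off out; rewrite -eqX => X.
  rewrite -(relabelK i r (west _ _ _)) -(relabelK i r (north _ _ _)) -eqW -eqN.
  apply: relabel_lt; first exact: ascE.
  case=> Wi Ni; have [lt_rn lt_cn] := cross_lt X.
  have later : (0 < r) || (r == 0) && (c < n) by case: (r).
  by have := ascending_cross ascE X later; rewrite Wi Ni; lia.
Qed.

(* Otherwise the pipe i + 1, which turns north at (i + 1, p), crosses at      *)
(* (i, p) either the pipe i or a pipe that it has crossed before.             *)
Lemma first_elbow n i p (E : pipe_dream n) :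
    reduced E -> pos E 0 n i < pos E 0 n i.+1 ->
    (forall c, c < p -> cross E i.+1 c) -> ~~ cross E i.+1 p ->
  ~~ cross E i p.
Proof.
move=> redE lt_pos bottom elbow; have /reducedP ascE := redE.
have Wb c : c <= p -> west E i.+1 c = i.+1.
  elim: c => // c IHc lt_cp.
  by rewrite westS bottom // IHc // ltnW.
(* A pipe that enters the row i from the south before column p has just gone up through a cross of
   the row i + 1, where it met the pipe i + 1. *)
have early c : c <= p -> west E i c = i \/
    exists2 q, q < c & cross_at E (west E i c) i.+1 i.+1 q /\ i.+1 < west E i c.
  elim: c => [|c IHc] lt_cp; first by left.
  rewrite westS; case: ifP => _.
    have [->|[q lt_qc Xq]] := IHc (ltnW lt_cp); first by left.
    by right; exists q; first exact: ltnW.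
  right; exists c => //; rewrite northE bottom //; split; last exact: north_ge.
  apply/cross_atP; split; first exact: bottom.
  by right; rewrite Wb // ltnW.
apply/negP => X; have Np : north E i.+1 p = i.+1.
  by rewrite northE (negPf elbow) Wb.
have [Wi|[q lt_qp [Xq lt_W]]] := early p (leqnn p).
  have [lt_in lt_pn] := cross_lt X.
  have later : (0 < i) || (i == 0) && (p < n) by case: (i).
  by have := ascending_cross ascE X later; rewrite Wi Np; lia.
have Xp : cross_at E (west E i p) i.+1 i p.
  by apply/cross_atP; split=> //; left.
by have [] := redE _ _ _ _ _ _ _ Xp Xq; lia.
Qed.

(** * Uniqueness and existence of the parent *)

Lemma parent_uniq n i p p' (D D' E : pipe_dream n) :
  is_offspring i p D E -> is_offspring i p' D' E -> p = p' /\ D = D'.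
Proof.
move=> off off'; have eq_p : p = p'.
  case: (ltngtP p p') => // lt_p.
    by have := offspring_bottom off' lt_p;
      rewrite (negPf (offspring_end_bottom off)).
  by have := offspring_bottom off lt_p;
    rewrite (negPf (offspring_end_bottom off')).
split=> //; rewrite -{p'}eq_p in off'; apply: cross_inj => r c.
case: (inside_or_outside i p r c) => [[-> le_cp]|[-> le_cp]|out].
- by rewrite (offspring_parent_top off) // (offspring_parent_top off').
- have [->|neq_cp] := eqVneq c p.
    by rewrite (negPf (offspring_parent_end off)) (negPf (offspring_parent_end
      off')).
  by rewrite -(offspring_moved off) -?(offspring_moved off') //; lia.
by have [<- _ _] := offspring_outside off out;
  have [<- _ _] := offspring_outside off' out.
Qed.

Lemma offspring_uniq n i p (D E E' : pipe_dream n) :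
  is_offspring i p D E -> is_offspring i p D E' -> E = E'.
Proof.
move=> off off'; apply: cross_inj => r c.
have [eq_cp|neq_cp] := eqVneq c p.
  case: (inside_or_outside i p r c) => [[-> _]|[-> _]|out]; rewrite ?eq_cp.
  - by rewrite (negPf (offspring_end_top off)) (negPf (offspring_end_top off')).
  - by rewrite (negPf (offspring_end_bottom off)) (negPf (offspring_end_bottom
      off')).
  rewrite -eq_cp.
  by have [-> _ _] := offspring_outside off out;
    have [-> _ _] := offspring_outside off' out.
case: (inside_or_outside i p r c) => [[-> le_cp]|[-> le_cp]|out].
- by rewrite (offspring_moved off) ?(offspring_moved off') //; lia.
- by rewrite (offspring_bottom off) ?(offspring_bottom off') //; lia.
by have [-> _ _] := offspring_outside off out;
  have [-> _ _] := offspring_outside off' out.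
Qed.

Lemma parent_exists n i p (E : pipe_dream n) :
    i.+1 < n -> p < n -> (forall c, c < p -> cross E i.+1 c) ->
    ~~ cross E i.+1 p -> ~~ cross E i p ->
  exists D, is_offspring i p D E.
Proof.
move=> lt_in lt_pn bottom end_bottom end_top.
(* Mitosis undone: the first p boxes of the row i move down, and the row i is filled with crosses up
   to column p. *)
pose in_parent (r c : nat) := if c <= p then
    if r == i then true else
    if r == i.+1 then (c < p) && cross E i c else cross E r c
  else cross E r c.
pose D : pipe_dream n := [set x : 'I_n * 'I_n | in_parent x.1 x.2].
have crossD r c : cross D r c = in_parent r c.
  have [lt_rn|le_nr] := ltnP r n; last first.
    have [neq_i neq_i1] : r != i /\ r != i.+1 by lia.
    rewrite /in_parent (negPf neq_i) (negPf neq_i1) if_same.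
    by rewrite !cross_out ?le_nr.
  have [lt_cn|le_nc] := ltnP c n; last first.
    by rewrite /in_parent !cross_out ?le_nc ?orbT // leqNgt (leq_trans lt_pn).
  by rewrite (crossE D (Ordinal lt_rn) (Ordinal lt_cn)) inE.
exists D; split=> //; rewrite ?crossD /in_parent.
- by move=> r c /negPf neq_i /negPf neq_i1;
    rewrite crossD /in_parent neq_i neq_i1 if_same.
- by move=> r c lt_pc; rewrite crossD /in_parent leqNgt lt_pc.
- by move=> c le_cp; rewrite crossD /in_parent le_cp eqxx.
- by rewrite leqnn gtn_eqF // eqxx ltnn.
- by move=> c lt_cp;
    rewrite crossD /in_parent (ltnW lt_cp) gtn_eqF // eqxx lt_cp.
Qed.

(** * Staying inside the staircase *)

Lemma staircaseP n (D : pipe_dream n) :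
  reflect (forall r c, cross D r c -> r + c + 2 <= n) (D \subset staircase n).
Proof.
apply: (iffP subsetP) => [sub r c /crossP[[i j] /sub]|sub [r c] Dx].
  by rewrite inE addSn addnS addn2 => + [-> ->].
by rewrite inE /=; have := sub r c; rewrite crossE Dx => /(_ isT); lia.
Qed.

(** The cross of [D] at (i, p) lies on or beyond the antidiagonal of every cross moved to the row i
    + 1. *)
Lemma offspring_staircase n i p (D E : pipe_dream n) :
  is_offspring i p D E -> D \subset staircase n -> E \subset staircase n.
Proof.
move=> off /staircaseP sub; apply/staircaseP => r c.
case: (inside_or_outside i p r c) => [[-> le_cp]|[-> le_cp]|out].
- by move=> _; apply/sub/(offspring_parent_top off).
- have := sub i p (offspring_parent_top off (leqnn p)).
  have [->|neq_cp le_n _] := eqVneq c p; last by lia.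
  by rewrite (negPf (offspring_end_bottom off)).
by have [-> _ _] := offspring_outside off out; apply: sub.
Qed.

(** The cross of [E] at (i + 1, p - 1) bounds the new crosses of the row i; for p = 0 the bound is i
    + 1 < n. *)
Lemma parent_staircase n i p (D E : pipe_dream n) :
    is_offspring i p D E -> i.+1 < n -> E \subset staircase n ->
  D \subset staircase n.
Proof.
move=> off lt_in /staircaseP sub; apply/staircaseP => r c.
case: (inside_or_outside i p r c) => [[-> le_cp _]|[-> le_cp]|out].
- case: p off le_cp => [|p] off le_cp; first by lia.
  by have := sub _ _ (offspring_bottom off (ltnSn p)); lia.
- have [->|neq_cp _] := eqVneq c p;
    first by rewrite (negPf (offspring_parent_end off)).
  by apply/sub/(offspring_bottom off); lia.
by have [<- _ _] := offspring_outside off out; apply: sub.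
Qed.

(** * From the definition of mitosis to the relation [is_offspring] *)

Lemma lt_startP n (i : 'I_n) (D : pipe_dream n) (j : 'I_n) :
  reflect (forall c, c <= j -> cross D i c) (j < start i D).
Proof.
apply: (iffP idP) => [lt_j c le_cj|row].
  have lt_cn : c < n by apply: leq_ltn_trans le_cj (ltn_ord j).
  apply: contraLR lt_j; rewrite -leqNgt (crossE D i (Ordinal lt_cn)) => Dc.
  apply: leq_trans le_cj; rewrite /start.
  have: Ordinal lt_cn \in index_enum 'I_n by rewrite mem_index_enum.
  elim: (index_enum _) => // k s IHs;
    rewrite inE big_cons => /predU1P[<-|/IHs le_s].
    by rewrite Dc geq_minl.
  by case: ifP => // _; apply: leq_trans (geq_minr _ _) le_s.
rewrite /start; elim/big_ind: _ => [//|a b lt_a lt_b|k Dk].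
  by rewrite leq_min lt_a.
by rewrite ltnNge; apply: contra Dk => /row; rewrite crossE.
Qed.

Lemma mem_colsP n (i : 'I_n.-1) (D : pipe_dream n) (p : 'I_n) :
  reflect ((forall c, c <= p -> cross D i c) /\ ~~ cross D i.+1 p)
          (p \in mitosis_cols i D).
Proof.
rewrite inE -(crossE D (next_row i) p).
apply: (iffP andP) => -[top bottom]; split=> //.
  exact: (lt_startP (this_row i) D p top).
exact/(lt_startP (this_row i)).
Qed.

Lemma mem_row n (a b i : 'I_n) (A : {set 'I_n}) :
  ((a, b) \in [set (i, j) | j in A]) = (a == i) && (b \in A).
Proof.
apply/imsetP/andP => [[j Aj [-> ->]]|[/eqP-> Ab]]; first by rewrite eqxx.
by exists b.
Qed.

Lemma cross_offspring n (i : 'I_n.-1) (D : pipe_dream n) (p : 'I_n) r c :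
    p \in mitosis_cols i D ->
  cross (offspring i D p) r c =
    if c < p then
      if r == i then cross D i.+1 c else (r == i.+1) || cross D r c
    else cross D r c && ((r != i) || (c != p)).
Proof.
move=> /[dup] colsp /mem_colsP[top bottom].
have lt_in := next_row_subproof i; have lt_pn := ltn_ord p.
have [lt_rn|le_nr] := ltnP r n; last first.
  have [neq_i neq_i1] : r != i /\ r != i.+1 by lia.
  by rewrite (negPf neq_i) (negPf neq_i1) !cross_out ?le_nr // if_same.
have [lt_cn|le_nc] := ltnP c n; last first.
  by rewrite !cross_out ?le_nc ?orbT // ltnNge (leq_trans (ltnW lt_pn)).
rewrite (crossE _ (Ordinal lt_rn) (Ordinal lt_cn)) !inE !mem_row !inE.
rewrite -!crossE /= xpair_eqE -!val_eqE /=.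
have [lt_cp|le_pc] := ltnP c p; last by rewrite !andbF orbF /= andbC negb_and.
have startc : c < start (this_row i) D.
  apply/(@lt_startP _ _ _ (Ordinal lt_cn)) => c' le_c.
  exact/top/(leq_trans le_c)/ltnW.
rewrite startc /= !andbT (ltn_eqF lt_cp) andbF /=.
have [->|neq_ri] := eqVneq r i.
  by rewrite ltn_eqF //= orbF top ?negbK ?andbT // ltnW.
by have [->|//] := eqVneq r i.+1; rewrite /= ?orbF //; case: cross.
Qed.

Lemma offspringP n (i : 'I_n.-1) (D : pipe_dream n) (p : 'I_n) :
  p \in mitosis_cols i D -> is_offspring i p D (offspring i D p).
Proof.
move=> /[dup] colsp /mem_colsP[top bottom].
split=> //.
- by move=> r c neq_i neq_i1;
    rewrite cross_offspring // neq_i (negPf neq_i) (negPf neq_i1) andbT if_same.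
- by move=> r c lt_pc;
    rewrite cross_offspring // ltnNge (ltnW lt_pc) (gtn_eqF lt_pc) orbT andbT.
- by move=> c lt_cp; rewrite cross_offspring // lt_cp gtn_eqF // eqxx.
- by move=> c lt_cp; rewrite cross_offspring // lt_cp eqxx.
- by rewrite cross_offspring // ltnn !eqxx andbF.
- by rewrite cross_offspring // ltnn (negPf bottom).
Qed.

Lemma mitosisP n (i : 'I_n.-1) (D E : pipe_dream n) :
  reflect (exists2 p : nat, p < n & is_offspring i p D E) (E \in mitosis i D).
Proof.
apply: (iffP imsetP) => [[p colsp ->]|[p lt_pn off]].
  by exists p => //; apply: offspringP.
have colsp : Ordinal lt_pn \in mitosis_cols i D.
  by apply/mem_colsP; split;
    [apply: offspring_parent_top off|apply: offspring_parent_end off].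
by exists (Ordinal lt_pn) => //; apply: offspring_uniq off (offspringP colsp).
Qed.

Lemma mitosis_disjoint n (i : 'I_n.-1) (D D' : pipe_dream n) :
  D <> D' -> [disjoint mitosis i D & mitosis i D'].
Proof.
move=> neq_D; apply/pred0P => E /=; apply/negP => /andP[].
by move=> /mitosisP[p _ off] /mitosisP[p' _ /(parent_uniq off)[]].
Qed.

(** * The recursion at a descent *)

Lemma RP_P n (w : 'S_n) (D : pipe_dream n) :
  reflect [/\ D \subset staircase n, reduced D
            & forall k : 'I_n, north D 0 (w k) = k] (D \in RP w).
Proof.
rewrite inE; apply: (iffP (asboolP _)) => -[sub redD ex]; split=> // k.
  exact/exitsP.
exact/exitsP.
Qed.

Lemma RP_pos n (w : 'S_n) (D : pipe_dream n) (k : 'I_n) :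
  D \in RP w -> pos D 0 n k = w k.
Proof. by case/RP_P => _ _ ex; rewrite -{1}(ex k) pos_top. Qed.

Lemma simpleE n (i : 'I_n.-1) (k : 'I_n) : simple i k = adj_swap i k :> nat.
Proof.
rewrite /simple permE /= /adj_swap -!val_eqE /=.
by case: eqP => // _; case: eqP.
Qed.

Lemma pmulE n (u v : 'S_n) k : pmul u v k = u (v k).
Proof. exact: permM. Qed.

Lemma RP_pmul_simple n (w : 'S_n) (i : 'I_n.-1) :
    w (next_row i) < w (this_row i) ->
  RP (pmul w (simple i)) = \bigcup_(D in RP w) mitosis i D.
Proof.
move=> desc; apply/setP => E;
  apply/idP/bigcupP => [RPE|[D RPD /mitosisP[p lt_pn off]]].
  have [subE redE exE] := RP_P _ _ RPE; have lt_in := next_row_subproof i.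
  have lt_pos : pos E 0 n i < pos E 0 n i.+1.
    rewrite (RP_pos (this_row i) RPE) (RP_pos (next_row i) RPE) !pmulE.
    by rewrite /simple tpermL tpermR.
  (* Column n is outside the grid, so it carries an elbow. *)
  have elbow : exists c, ~~ cross E i.+1 c by exists n;
    rewrite cross_out // leqnn orbT.
  case: (ex_minnP elbow) => p end_bottom min_p.
  have bottom c : c < p -> cross E i.+1 c.
    by move=> lt_cp; apply: contraLR lt_cp => /min_p; rewrite -leqNgt.
  (* A full row i + 1 would leave the staircase at column n - 1. *)
  have lt_pn : p < n.
    rewrite ltnNge; apply/negP => le_np; have lt0n : n.-1 < p by lia.
    by have /staircaseP/(_ _ _ (bottom _ lt0n)) := subE; lia.
  have end_top := first_elbow redE lt_pos bottom end_bottom.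
  have [D off] := parent_exists lt_in lt_pn bottom end_bottom end_top.
  exists D; last by apply/mitosisP; exists p.
  apply/RP_P; split; first exact: parent_staircase off lt_in subE.
    exact: parent_reduced off redE lt_pos.
  move=> k; have := exE (simple i k); rewrite pmulE simpleE.
  rewrite /simple tpermK (offspring_north _ off) //.
  by move/(can_inj (adj_swapK i)).
have [subD redD exD] := RP_P _ _ RPD; apply/RP_P; split.
- exact: offspring_staircase off subD.
- exact: offspring_reduced off redD.
- by move=> k; rewrite pmulE (offspring_north _ off) // exD simpleE adj_swapK.
Qed.

(** * Descents and the exchange condition *)

(** At an ascent i of w, applying s_i to both entries embeds the inversions of w into those of w
    s_i, so the length cannot drop. *)
Lemma perm_length_descent n (w : 'S_n) (i : 'I_n.-1) :
    perm_length (pmul w (simple i)) < perm_length w ->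
  w (next_row i) < w (this_row i).
Proof.
apply: contraLR; rewrite -!leqNgt => le_w.
pose f (x : 'I_n * 'I_n) := (simple i x.1, simple i x.2).
have f_inj : injective f by move=> [a b] [c d] [/perm_inj-> /perm_inj->].
rewrite /perm_length -(card_imset _ f_inj); apply/subset_leq_card/subsetP.
move=> _ /imsetP[[a b] + ->]; rewrite !inE /= => /andP[lt_ab lt_w].
rewrite !pmulE /simple !tpermK lt_w andbT -/(simple i) !simpleE.
apply: adj_swap_lt lt_ab _ => -[eq_a eq_b].
have [eq_a' eq_b'] : a = this_row i /\ b = next_row i by split; apply: val_inj.
by move: lt_w; rewrite eq_a' eq_b' ltnNge le_w.
Qed.

Lemma long_permE n (k : 'I_n) : long_perm n k = n - k.+1 :> nat.
Proof. by rewrite permE. Qed.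

Lemma pmul_longK n : involutive (pmul (long_perm n)).
Proof. by move=> u; apply/permP => k; rewrite !pmulE !permE rev_ordK. Qed.

Lemma word_prod_rcons n (t : seq 'I_n.-1) i :
  word_prod (rcons t i) = pmul (word_prod t) (simple i).
Proof.
elim: t => [|j t IHt] /=; first by rewrite /pmul mul1g mulg1.
by rewrite IHt /pmul mulgA.
Qed.

Lemma simple_conj n (v : 'S_n) (i j : 'I_n.-1) :
    v (this_row i) = this_row j -> v (next_row i) = next_row j ->
  pmul (pmul (simple j) v) (simple i) = v.
Proof.
move=> eq_this eq_next; have conj : (simple i ^ v = simple j)%g.
  by rewrite tpermJ eq_this eq_next.
by rewrite /pmul -conj -conjgC mulgA tperm2 mul1g.
Qed.

(** Let j be the first letter and v the product of the others. If i is a descent of v, induction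
    applies to the tail. Otherwise s_j has created the descent, so v sends i, i + 1 to j, j + 1 and
    s_j v s_i = v: the letter j is dropped. *)
Lemma word_exchange n (t : seq 'I_n.-1) (i : 'I_n.-1) :
    word_prod t (next_row i) < word_prod t (this_row i) ->
  exists2 t', size t' < size t & word_prod t' = pmul (word_prod t) (simple i).
Proof.
elim: t => [|j t IHt] /=; first by rewrite !perm1 /=; lia.
rewrite !pmulE !simpleE => desc.
case: (ltngtP (word_prod t (next_row i)) (word_prod t (this_row i))) =>
  [|lt_v|eq_v].
- by case/IHt => t' lt_t' eq_t'; exists (j :: t');
    rewrite //= eq_t' /pmul mulgA.
- exists t => //; rewrite simple_conj //.
    case: (pselect (val (word_prod t (this_row i)) = j /\
                    val (word_prod t (next_row i)) = j.+1)) => [[]|].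
      by move=> eq_this _; apply: val_inj.
    by move/(adj_swap_lt lt_v); lia.
  case: (pselect (val (word_prod t (this_row i)) = j /\
                  val (word_prod t (next_row i)) = j.+1)) => [[]|].
    by move=> _ eq_next; apply: val_inj.
  by move/(adj_swap_lt lt_v); lia.
- by move/val_inj/perm_inj/(congr1 val): eq_v => /=; lia.
Qed.

(** * The long permutation and reduced words *)

Lemma cross_staircase n r c : cross (staircase n) r c = (r + c + 2 <= n).
Proof.
apply/idP/idP => [|le_n]; first by apply/staircaseP.
have [lt_rn lt_cn] : r < n /\ c < n by lia.
rewrite (crossE _ (Ordinal lt_rn) (Ordinal lt_cn)) inE /=; lia.
Qed.

Lemma staircase_label n r c : r + c < n ->
  west (staircase n) r c = r /\ north (staircase n) r c = n.-1 - c.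
Proof.
move: r c; apply: (@row_ind n) => [r le_nr c|r IHr]; first by lia.
have W c : r + c < n -> west (staircase n) r c = r.
  elim: c => // c IHc lt_n; rewrite westS cross_staircase ifT; last by lia.
  by rewrite IHc //; lia.
move=> c lt_n; split; first exact: W.
rewrite northE cross_staircase; case: leqP => ?; last by rewrite W //; lia.
by have [|_ ->] := IHr c; first by lia.
Qed.

(** All pairs of pipes from the n rows end up inverted, hence cross somewhere in [D]. Distinct pairs
    need distinct crosses, so [D] has at least as many boxes as the staircase that contains it. *)
Lemma RP_long_perm n : RP (long_perm n) = [set staircase n].
Proof.
apply/setP => D; rewrite in_set1; apply/idP/eqP => [RPD|->]; last first.
  apply/RP_P; split=> //.
    apply/reducedP => r c; rewrite cross_staircase => le_n.
    have [|-> _] := @staircase_label n r c; first by lia.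
    have [|_ ->] := @staircase_label n r.+1 c; first by lia.
    lia.
  move=> k; have lt_k := ltn_ord k; rewrite long_permE.
  by have [|_ ->] := @staircase_label n 0 (n - k.+1); lia.
have [subD _ _] := RP_P _ _ RPD.
apply/eqP; rewrite eqEcard subD /=.
pose pair_of (x : 'I_n * 'I_n) := (west D x.1 x.2, north D x.1.+1 x.2).
(* For a box of the staircase, these are the pipes that cross there when the staircase is full. *)
pose stair_pair (x : 'I_n * 'I_n) : nat * nat := (x.1 : nat, n - x.2.+1).
rewrite cardE -(size_map stair_pair) cardE -(size_map pair_of).
apply: uniq_leq_size.
  rewrite map_inj_uniq ?enum_uniq // => -[a b] [c d] [/val_inj-> eq_b].
  congr (_, _); apply: val_inj => /=; have := ltn_ord b; have := ltn_ord d; lia.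
move=> _ /mapP[[a b] + ->]; rewrite mem_enum inE /= => le_ab.
have lt_bn : n - b.+1 < n by lia.
have lt_ab : a < n - b.+1 by lia.
have inv : pos D 0 n (n - b.+1) < pos D 0 n a.
  by rewrite (RP_pos a RPD) (RP_pos (Ordinal lt_bn) RPD) !long_permE /=; lia.
have [r [c [_ X eqW eqN]]] := inverted_cross lt_ab inv.
have [lt_rn lt_cn] := cross_lt X; apply/mapP.
exists (Ordinal lt_rn, Ordinal lt_cn); last by rewrite /pair_of /= eqW eqN.
by rewrite mem_enum -(crossE D (Ordinal lt_rn)).
Qed.

(** A prefix of a reduced word is reduced. By exchange its next letter is an ascent of its product,
    which the long permutation turns into a descent. *)
Lemma RP_reduced_word n (t : seq 'I_n.-1) :
    (forall t', word_prod t' = word_prod t -> size t <= size t') ->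
  RP (pmul (long_perm n) (word_prod t)) =
    foldl (fun P i => mitosis_set i P) [set staircase n] t.
Proof.
elim/last_ind: t => [_|t i IHt min_t].
  by rewrite (_ : pmul _ _ = long_perm n) ?RP_long_perm // /pmul /= mul1g.
rewrite foldl_rcons -IHt => [|t' eq_t']; last first.
  have := min_t (rcons t' i); rewrite !word_prod_rcons eq_t' !size_rcons.
  exact.
have asc : word_prod t (this_row i) < word_prod t (next_row i).
  rewrite ltnNge leq_eqVlt; apply/norP; split.
    by apply/eqP => /val_inj/perm_inj/(congr1 val) /=; lia.
  apply/negP => /word_exchange[t' lt_t' eq_t'].
  have := min_t t'; rewrite word_prod_rcons size_rcons => /(_ eq_t'); lia.
rewrite word_prod_rcons.
rewrite (_ : pmul _ _ = pmul (pmul (long_perm n) (word_prod t)) (simple i)).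
  apply: RP_pmul_simple; rewrite !pmulE !long_permE.
  by have := ltn_ord (word_prod t (next_row i)); lia.
by rewrite /pmul mulgA.
Qed.

Theorem theorem3 (n : nat) (w : 'S_n) :
  (forall i : 'I_n.-1,
      perm_length (pmul w (simple i)) < perm_length w ->
      RP (pmul w (simple i)) = \bigcup_(D in RP w) mitosis i D /\
      (forall D E : pipe_dream n, D \in RP w -> E \in RP w -> D <> E ->
         [disjoint mitosis i D & mitosis i E])) /\
  RP (long_perm n) = [set staircase n] /\
  (forall t : seq 'I_n.-1,
      reduced_expression t (pmul (long_perm n) w) ->
      RP w = foldl (fun P i => mitosis_set i P) [set staircase n] t).
Proof.
split=> [i /perm_length_descent desc|].
  split; first exact: RP_pmul_simple.
  by move=> D E _ _; apply: mitosis_disjoint.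
split=> [|t [eq_t min_t]]; first exact: RP_long_perm.
by rewrite -{1}(pmul_longK w) -eq_t RP_reduced_word // => t'; rewrite eq_t;
  apply: min_t.
Qed.
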